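(* Let $k\geq 1$, let $L=\{U_1,\ldots,U_k\}$ be the first-order language with $k$ unary predicate symbols, let $1\leq p\leq k$, let $\bar{s}=\langle i_1,\ldots,i_p\rangle$ with $1\leq i_1<\cdots<i_p\leq k$, let $e\in\{0,1\}^k$, and let $\phi_{\bar{s},e}(x)=U_{i_1}^{e(i_1)}(x)\wedge\cdots\wedge U_{i_p}^{e(i_p)}(x)$ be the corresponding basic property of $L$. (i) If $p=1$, then $d(\phi_{\bar{s},e}:\mathrm{typ})=1/2$. (ii) If $p\geq 2$, then $d(\phi_{\bar{s},e}:\mathrm{typ})=0$. (In each case the limit defining $d(\phi_{\bar s,e}:\mathrm{typ})$ exists and has the stated value.)
   Context: For a predicate symbol $U_i$ put $U_i^{1}(x)=U_i(x)$ and $U_i^{0}(x)=\neg U_i(x)$. For a language $L$ let $\mathbf{S}_n(L)$ be the set of $L$-structures with universe $\{1,\ldots,n\}$. For a formula $\phi(x)$ of $L$ with one free variable and without parameters (a ''property''), and an $L$-structure $\mathcal{M}$ with universe $M$, let $\phi(\mathcal{M})=\{a\in M:\mathcal{M}\models\phi(a)\}$. The property $\phi(x)$ is typical for a finite structure $\mathcal{M}$ with $|M|=n$ if $|\phi(\mathcal{M})|>n/2$. Let $\mathbf{S}_n(\phi:\mathrm{typ})=\{\mathcal{M}\in\mathbf{S}_n(L):|\phi(\mathcal{M})|>n/2\}$, $d_n(\phi:\mathrm{typ})=|\mathbf{S}_n(\phi:\mathrm{typ})|/|\mathbf{S}_n(L)|$, and $d(\phi:\mathrm{typ})=\lim_{n\to\infty}d_n(\phi:\mathrm{typ})$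 whenever this limit exists. *)

(* Defs.v *)
From mathcomp Require Import all_boot all_order all_algebra.
From mathcomp Require Import all_classical all_reals all_analysis.
Set Implicit Arguments.
Unset Strict Implicit.
Unset Printing Implicit Defensive.
Import Order.TTheory GRing.Theory Num.Theory.
Import numFieldNormedType.Exports.
Local Open Scope ring_scope.
Local Open Scope classical_set_scope.

(* Finite relational languages: there are no function symbols, so the only
   terms are variables. *)
Record language := Language { symbol : finType; arity : symbol -> nat }.

(* [formula L m] is the type of first-order formulas of [L], with equality,
   whose free variables are among m variables indexed by ['I_m].  In [FEx f]
   the bound variable of [f] is [ord0], and the variable i of the context
   becomes [lift ord0 i]. *)
Inductive formula (L : language) : nat -> Type :=
| FFalse m : formula L m
| FRel m (r : symbol L) (t : (arity r).-tuple 'I_m) : formula L m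
| FEq m (i j : 'I_m) : formula L m
| FNot m (f : formula L m) : formula L m
| FAnd m (f g : formula L m) : formula L m
| FEx m (f : formula L m.+1) : formula L m.

Arguments FFalse {L m}.
Arguments FRel {L m} r t.
Arguments FEq {L m} i j.
Arguments FNot {L m} f.
Arguments FAnd {L m} f g.
Arguments FEx {L m} f.

Definition property (L : language) := formula L 1.

(* The L-structures with universe ['I_n], which plays the role of {1, ..., n}:
   each symbol is interpreted by a set of tuples. *)
Definition structure (L : language) (n : nat) :=
  {dffun forall r : symbol L, {set (arity r).-tuple 'I_n}}.

Definition extend n m (v : 'I_m -> 'I_n) (a : 'I_n) (i : 'I_m.+1) : 'I_n :=
  oapp v a (unlift ord0 i).

Fixpoint sat L n (M : structure L n) m (f : formula L m) :
    ('I_m -> 'I_n) -> bool :=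
  match f in formula _ m return ('I_m -> 'I_n) -> bool with
  | FFalse _ => fun=> false
  | FRel _ r t => fun v => map_tuple v t \in M r
  | FEq _ i j => fun v => v i == v j
  | FNot _ f => fun v => ~~ sat M f v
  | FAnd _ f g => fun v => sat M f v && sat M g v
  | FEx _ f => fun v => [exists a, sat M f (extend v a)]
  end.

Definition solutions L n (phi : property L) (M : structure L n) : {set 'I_n} :=
  [set a | sat M phi (fun=> a)]%SET.

Definition typical L n (phi : property L) (M : structure L n) : bool :=
  n%:R / 2%:R < #|solutions phi M|%:R :> rat.

Definition typical_structures L (phi : property L) n : {set structure L n} :=
  [set M | typical phi M]%SET.

Definition typ_fraction (R : realType) L (phi : property L) (n : nat) : R :=
  #|typical_structures phi n|%:R / #|structure L n|%:R.

(* The limit defining d(phi : typ) exists and is equal to l. *)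
Definition typ_density_is (R : realType) L (phi : property L) (l : R) : Prop :=
  typ_fraction R phi n @[n --> \oo] --> l.

Definition unary_language (k : nat) : language :=
  @Language 'I_k (fun=> 1%N).

Definition literal k (i : 'I_k) (b : bool) : property (unary_language k) :=
  let U_i := @FRel (unary_language k) 1 i [tuple ord0] in
  if b then U_i else FNot U_i.

(* The value on the empty list is a convention: only nonempty conjunctions
   occur as basic properties. *)
Fixpoint conjunction L m (fs : seq (formula L m)) : formula L m :=
  match fs with
  | [::] => FNot FFalse
  | [:: f] => f
  | f :: fs' => FAnd f (conjunction fs')
  end.

Definition basic_property k p (s : p.-tuple 'I_k) (e : {ffun 'I_k -> bool}) :
    property (unary_language k) :=
  conjunction [seq literal i (e i) | i <- s].

(* Main.v *)
(* A structure amounts to a choice, for each element, of a truth assignment of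
   the k predicates, so the solution set of the property is a random subset of
   the universe in which each element lies independently with probability
   2^-p.  If p = 1, all subsets are equally likely; complementation exchanges
   the subsets with more than n/2 elements and those with less than n/2, and
   the ties have probability O(1/sqrt n) by the bound
   C(2m, m)^2 (2m + 1) <= 16^m.  If p >= 2, the probability is at most 1/4 and
   the Chernoff estimate E[4^|A|] / 2^n <= (7/4)^n / 2^n applies. *)
Require Import Defs.
From mathcomp Require Import all_boot all_order all_algebra.
From mathcomp Require Import all_classical all_reals all_analysis.
From mathcomp Require Import zify ring lra.
Set Implicit Arguments.
Unset Strict Implicit.
Unset Printing Implicit Defensive.
Import Order.TTheory GRing.Theory Num.Theory.
Import numFieldNormedType.Exports.
Local Open Scope nat_scope.

(** Each index in [s] has its value forced and every other index keeps two choices. The product form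
    avoids a truncated subtraction in the exponent. *)
Lemma card_agree (I : finType) (s : seq I) (e : {ffun I -> bool}) :
  uniq s ->
  #|[pred v : {ffun I -> bool} | all (fun i => v i == e i) s]| * 2 ^ size s
  = 2 ^ #|I|.
Proof.
move=> us.
pose F i := if i \in s then pred1 (e i) else predT.
have -> : #|[pred v : {ffun I -> bool} | all (fun i => v i == e i) s]|
          = #|family F|.
  apply: eq_card => v; apply/allP/familyP => [h i | h i si].
    by rewrite /F; case: ifP => // si; apply: h.
  by have := h i; rewrite /F si.
rewrite card_family foldrE big_image /= -(card_uniqP us) -!prod_nat_const.
rewrite [X in _ * X]big_mkcond -big_split /=.
apply: eq_bigr => i _; rewrite /F; case: ifP => _; first by rewrite card1.
by rewrite muln1 (@eq_card _ _ predT) // card_bool.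
Qed.

Lemma prod_if_in (I : finType) (A : {set I}) x y :
  \prod_a (if a \in A then x else y) = x ^ #|A| * y ^ #|~: A|.
Proof.
rewrite big_if /= !prod_nat_const; congr (_ * _ ^ _).
by apply: eq_card => a; rewrite inE.
Qed.

(** Functions are grouped by the preimage [A] of [G]. Those with a given [A] form a product family:
    values in [G] on [A], outside [G] elsewhere. *)
Lemma card_ffun_preimage (I V : finType) (G : pred V) (P : pred {set I}) :
  #|[pred f : {ffun I -> V} | P [set a | G (f a)]%SET]|
  = \sum_(A | P A) #|G| ^ #|A| * #|[predC G]| ^ #|~: A|.
Proof.
rewrite -[LHS]sum1_card.
rewrite (partition_big (fun f : {ffun I -> V} => [set a | G (f a)]%SET) P) //=.
apply: eq_bigr => A PA.
pose F a := if a \in A then G else [predC G].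
rewrite (eq_bigl (mem (family F))) ?sum1_card.
  rewrite card_family foldrE big_image /= -prod_if_in.
  by apply: eq_bigr => a _; rewrite /F; case: ifP.
move=> f; rewrite !inE; apply/andP/familyP => [[_ /eqP fA] a | fF].
  by rewrite /F -fA inE; case: ifP => //= h; rewrite inE; apply/negbT.
suff fA : [set a | G (f a)]%SET = A by rewrite fA.
apply/setP => a; rewrite inE; have := fF a; rewrite /F.
by case: ifP => // _; rewrite inE => /negbTE.
Qed.

Definition truth_table k n (M : structure (unary_language k) n) :
  {ffun 'I_n -> {ffun 'I_k -> bool}} :=
  [ffun a => [ffun i => [tuple a] \in M i]].

Lemma truth_table_bij k n : bijective (@truth_table k n).
Proof.
pose g (f : {ffun 'I_n -> {ffun 'I_k -> bool}}) :
    structure (unary_language k) n :=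
  [ffun i : symbol (unary_language k) =>
     [set t : 1.-tuple 'I_n | f (thead t) i]%SET].
have tE (u : 1.-tuple 'I_n) : [tuple thead u] = u.
  by apply: val_inj; case/tupleP: u => a u; rewrite theadE (tuple0 u).
exists g => [M | f].
  apply/ffunP => i; rewrite ffunE; apply/setP => t; rewrite inE !ffunE.
  by rewrite tE.
by apply/ffunP => a; apply/ffunP => i; rewrite !ffunE inE theadE.
Qed.

Lemma sat_basic_property k p n (s : p.-tuple 'I_k) e (M : structure (unary_language k) n) a :
  sat M (basic_property s e) (fun=> a)
  = all (fun i => truth_table M a i == e i) s.
Proof.
rewrite /basic_property; elim: (tval s) => //= i s'.
have Hl : sat M (literal i (e i)) (fun=> a) = (truth_table M a i == e i).
  have -> : truth_table M a i = sat M (literal i true) (fun=> a).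
    have tE : [tuple a] = map_tuple (fun=> a) [tuple (ord0 : 'I_1)] by apply: val_inj.
    by rewrite !ffunE tE.
  by rewrite /literal; case: (e i) => /=; rewrite ?eqb_id ?eqbF_neg.
by case: s' => [|j s'] /= IH; rewrite Hl ?andbT // IH.
Qed.

Lemma card_structure k n :
  #|structure (unary_language k) n| = (2 ^ k) ^ n.
Proof.
by rewrite (bij_eq_card (@truth_table_bij k n)) !card_ffun card_bool !card_ord.
Qed.

Lemma card_typical_structures k p n (s : p.-tuple 'I_k) (e : {ffun 'I_k -> bool}) (us : uniq s)
    (G := [pred v : {ffun 'I_k -> bool} | all (fun i => v i == e i) s]) :
  #|typical_structures (basic_property s e) n|
  = \sum_(A : {set 'I_n} | n < #|A|.*2) #|G| ^ #|A| * #|[predC G]| ^ #|~: A|.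
Proof.
rewrite -card_ffun_preimage.
rewrite -(@on_card_preimset _ _ (@truth_table k n)); last first.
  exact/onW_bij/truth_table_bij.
(* Clearing the denominator turns the rational inequality of [typical] into one between natural
   numbers. *)
apply: eq_card => M; rewrite !inE /typical ltr_pdivrMr // -natrM ltr_nat muln2.
congr (_ < #|pred_of_set _|.*2); apply/setP => a.
by rewrite !inE sat_basic_property.
Qed.

(* Each A with n < 2|A| satisfies 2^n <= 4^|A|, and the product (4 g + h)^n
   expands into a sum over all subsets A. *)
Lemma upper_tail_le g h n :
  (\sum_(A : {set 'I_n} | n < #|A|.*2) g ^ #|A| * h ^ #|~: A|) * 2 ^ n
  <= (4 * g + h) ^ n.
Proof.
rewrite -[in X in _ <= X](card_ord n) -prod_nat_const bigA_distr big_distrl /=.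
rewrite big_mkcond; apply: leq_sum => A _; case: ifP => // ltnA.
rewrite prod_if_in expnMn -(expnM 2 2) mul2n [leqLHS]mulnC -mulnA leq_mul2r.
by rewrite leq_exp2l ?(ltnW ltnA) ?orbT.
Qed.

(** Induction: from [m] to [m.+1] the left side grows by the factor 4(2m+1)(2m+3)/(m+1)^2, which is
    at most 16 because (2m+1)(2m+3) <= (2m+2)^2. *)
Lemma central_bin_sqr_le m : 'C(m.*2, m) ^ 2 * m.*2.+1 <= 4 ^ m.*2.
Proof.
elim: m => // m IH; set c := 'C(m.*2, m) in IH *; set c' := 'C(_, _).
(* The two binomial coefficients are linked through C(2m+1, m). *)
have c'E : m.+1 * c' = 2 * (m.*2.+1 * c).
  have h1 := mul_bin_diag m.*2.+2 m; rewrite -/c' /= in h1.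
  have h2 := mul_bin_down m.*2.+1 m; rewrite -/c /= in h2.
  apply/eqP; rewrite -(eqn_pmul2l (ltn0Sn m)); apply/eqP.
  have e1 : m.*2.+1 - m = m.+1 by lia.
  rewrite e1 in h2.
  by rewrite -h1 h2 -doubleS -mul2n !mulnA.
have le1 : m.*2.+1 * m.*2.+3 <= 4 * m.+1 ^ 2 by rewrite -mul2n; nia.
rewrite -(@leq_pmul2l (m.+1 ^ 2)) ?expn_gt0 // mulnA -expnMn c'E doubleS.
rewrite [4 ^ _.+2]expnS [4 ^ _.+1]expnS !expnMn.
have := leq_mul le1 IH; rewrite -(@leq_pmul2l 4) //.
move: (4 ^ m.*2) (m.*2.+1) (m.*2.+3) => q u v le2.
apply: leq_trans (leq_trans le2 _); lia.
Qed.

Definition half_sets n : {set {set 'I_n}} := [set A : {set 'I_n} | #|A|.*2 == n]%SET.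

Lemma card_half_sets_sqr_le n : #|half_sets n| ^ 2 * n.+1 <= 4 ^ n.
Proof.
have [odd_n|even_n] := boolP (odd n).
  suff -> : half_sets n = finset.set0 by rewrite cards0.
  apply/setP => A; rewrite !inE; apply/negP => /eqP nE.
  by rewrite -nE odd_double in odd_n.
have nE : n = n./2.*2 by rewrite -[LHS]odd_double_half (negbTE even_n).
suff -> : #|half_sets n| = 'C(n, n./2) by have := central_bin_sqr_le n./2; rewrite -nE.
rewrite -[X in 'C(X, _)](card_ord n) -card_draws; apply: eq_card => A.
by rewrite !inE -[RHS](inj_eq double_inj) -nE.
Qed.

Lemma card_large_sets n :
  (#|[set A : {set 'I_n} | n < #|A|.*2]%SET|).*2 + #|half_sets n| = 2 ^ n.
Proof.
pose T := [set A : {set 'I_n} | n < #|A|.*2]%SET.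
pose B := [set A : {set 'I_n} | #|A|.*2 < n]%SET.
have cardsC' (A : {set 'I_n}) : #|A| + #|~: A| = n by rewrite cardsC card_ord.
have TB : #|T| = #|B|.
  rewrite -(card_imset T (@finset.setC_inj _)); apply: eq_card => A.
  apply/imsetP/idP => [[A' AT ->]|AT].
    rewrite !inE in AT *; have := cardsC' A'; lia.
  exists (~: A)%SET; last by rewrite finset.setCK.
  rewrite !inE in AT *; have := cardsC' A; lia.
have <- : #|{set 'I_n}| = 2 ^ n.
  by rewrite -cardsT -powersetT card_powerset cardsT card_ord.
(* The complement of [T] splits into [B] and the ties. *)
rewrite -/T -addnn {2}TB -(cardsC T) -addnA; congr (_ + _).
rewrite -[RHS](cardsID B); congr (_ + _); apply: eq_card => A; rewrite !inE; lia.
Qed.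

Local Close Scope nat_scope.
Local Open Scope ring_scope.

Lemma typ_fraction_rare (R : realType) k p (s : p.-tuple 'I_k)
    (e : {ffun 'I_k -> bool}) n :
  uniq s -> (2 <= p)%N ->
  typ_fraction R (basic_property s e) n <= (7 / 8) ^+ n.
Proof.
move=> us p2; rewrite /typ_fraction card_structure.
rewrite ler_pdivrMr ?ltr0n ?expn_gt0 // expr_div_n mulrAC ler_pdivlMr ?exprn_gt0 //.
rewrite -!natrX -!natrM ler_nat card_typical_structures //.
set g := #|_|%N; set h := #|_|%N.
have gh : (g + h = 2 ^ k)%N by rewrite cardC card_ffun card_bool card_ord.
have := card_agree e us; rewrite -/g card_ord size_tuple => gE.
have g4 : (4 * g <= 2 ^ k)%N.
  by rewrite -gE mulnC leq_mul2l (@leq_exp2l 2 2) ?p2 ?orbT.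
(* The factor 2 feeds [upper_tail_le]; the factor 4 clears the denominator in 4g + h = 3g + 2^k <=
   (7/4) 2^k. *)
rewrite (_ : 8 = 2 * 4)%N // expnMn mulnA.
apply: leq_trans (leq_mul (upper_tail_le g h n) (leqnn _)) _.
rewrite -!expnMn; case: (posnP n) => [->|n0]; first by rewrite !expn0.
by rewrite leq_exp2r; lia.
Qed.

Lemma typ_fraction_single (R : realType) k (s : 1.-tuple 'I_k)
    (e : {ffun 'I_k -> bool}) n :
  uniq s ->
  typ_fraction R (basic_property s e) n
  = (1 - #|half_sets n|%:R / 2 ^+ n) / 2.
Proof.
move=> us; rewrite /typ_fraction card_structure card_typical_structures //.
set g := #|[pred _ | _]|%N; set h := #|[predC _]|%N.
have gh : (g + h = 2 ^ k)%N by rewrite cardC card_ffun card_bool card_ord.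
have := card_agree e us; rewrite -/g card_ord size_tuple expn1 => gE.
(* A single literal holds for exactly half of the assignments, so every [A] gets the same weight
   g^n. *)
have -> : h = g by lia.
have g0 : (0 < g)%N by have := expn_gt0 2 k; lia.
under eq_bigr do rewrite -expnD cardsC card_ord.
rewrite sum_nat_cond_const -gE expnMn.
have := card_large_sets n.
rewrite (_ : #|[pred _ | _]|%N =
    #|[set A : {set 'I_n} | (n < #|A|.*2)%N]%SET|%N); last first.
  by apply: eq_card => A; rewrite !inE.
set T := #|[set _ | _]%SET|%N; set E := #|_|%N => TE.
have {TE} : (T%:R * 2 + E%:R = 2 ^+ n :> R) by rewrite -natrX -TE natrD -muln2 natrM.
rewrite !natrM !natrX => TE.
have g0R : (g%:R ^+ n != 0 :> R) by rewrite expf_neq0 // pnatr_eq0; lia.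
have t0 : (2 ^+ n != 0 :> R) by rewrite expf_neq0 // pnatr_eq0.
have -> : E%:R = 2 ^+ n - T%:R * 2 :> R by rewrite -TE addrC addKr.
by field; rewrite g0R t0.
Qed.

(** As [harmonic n] is 1/(n+1), this is the square root of [card_half_sets_sqr_le]. *)
Lemma half_sets_fraction_le (R : realType) n :
  #|half_sets n|%:R / 2 ^+ n <= Num.sqrt (harmonic n) :> R.
Proof.
apply: le_trans (ler_norm _) _; rewrite -sqrtr_sqr ler_wsqrtr //.
rewrite expr_div_n ler_pdivrMr ?exprn_gt0 // mulrC ler_pdivlMr ?ltr0n //.
rewrite -exprM mulnC exprM -!natrX -natrM ler_nat.
exact: card_half_sets_sqr_le.
Qed.

Local Open Scope classical_set_scope.

Theorem theorem4p2 (R : realType) (k : nat) (k_ge1 : (1 <= k)%N)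
    (p : nat) (p_ge1 : (1 <= p)%N) (p_le_k : (p <= k)%N)
    (s : p.-tuple 'I_k)
    (s_incr : forall a b : 'I_p, (a < b)%N -> (tnth s a < tnth s b)%N)
    (e : {ffun 'I_k -> bool}) :
  (p = 1%N -> typ_density_is (basic_property s e) (1 / 2%:R : R)) /\
  ((2 <= p)%N -> typ_density_is (basic_property s e) (0 : R)).
Proof.
have us : uniq s.
  apply/tuple_uniqP => a b sab; apply: val_inj => /=.
  case: (ltngtP a b) => // /s_incr; by rewrite sab ltnn.
split=> [p1 | p2]; rewrite /typ_density_is.
  subst p.
  (* The lower bound comes from the estimate on the fraction of ties, the upper one from its
     nonnegativity. *)
  apply: (@squeeze_cvgr _ _ _ _ (fun n => (1 - Num.sqrt (harmonic n)) / 2)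
            (fun=> 1 / 2)); last exact: cvg_cst.
    apply: nearW => n; rewrite typ_fraction_single // !ler_pM2r ?invr_gt0 //.
    rewrite lerD2l lerN2 half_sets_fraction_le gerBl.
    by rewrite divr_ge0 // exprn_ge0.
  apply: cvgMl; rewrite -[X in _ --> X]subr0.
  apply: cvgB; first exact: cvg_cst.
  rewrite -(sqrtr0 R); apply: continuous_cvg; first exact: sqrt_continuous.
  exact: cvg_harmonic.
apply: (@squeeze_cvgr _ _ _ _ (fun=> 0) (fun n => (7 / 8) ^+ n)).
- apply: nearW => n; rewrite typ_fraction_rare // andbT.
  by rewrite /typ_fraction divr_ge0.
- exact: cvg_cst.
- apply: cvg_expr; rewrite ger0_norm; lra.
Qed.
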